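(* Let $n\ge1$. The class of $(\langle\ \rangle;,\mathsf A_1,\dots,\mathsf A_n,\sqcup)$-algebras that are representable by injective $n$-ary partial functions is a quasivariety, finitely axiomatised by the following (quasi)equations (each universally quantified over all element variables occurring in it): (1) $\langle \boldsymbol a; b_1,\dots,\boldsymbol a; b_n\rangle ; c = \boldsymbol a;(\boldsymbol b; c)$; (2) $\boldsymbol\pi; a = a$; (3) $\langle \mathsf A_1^n a\rangle; a = 0$ (i.e. $\langle \mathsf A_1^n a\rangle; a=\langle \mathsf A_1^n b\rangle; b$ for all $a,b$, so that $0$ is a well-defined constant); (4) $\langle a_1,\dots,a_{i-1},0,a_{i+1},\dots,a_n\rangle; b = 0$ for every $i$; (5) $\boldsymbol a; 0 = 0$; (6) $\boldsymbol a;\mathsf A_i b = \langle \mathsf A_1^n(\boldsymbol a; b)\rangle;\langle \mathsf D_1^n a_1\rangle;\cdots;\langle \mathsf D_1^n a_n\rangle; a_i$ for every $i$; (7) $\langle \mathsf D_1^n a\rangle; b=\langle \mathsf D_1^n a\rangle; c \ \wedge\ \langle \mathsf A_1^n a\rangle; b=\langle \mathsf A_1^n a\rangle; c \ \rightarrow\ b=c$; (8) $\langle \mathsf D_1^n a\rangle; a = a$; (9) $\mathsf A_i\mathsf A_j a=\mathsf A_i\mathsf A_k a$ for every $i,j,k$; (10) $\boldsymbol b; a=\boldsymbol c; a\ \rightarrow\ \boldsymbol b;\mathsf D_i a=\boldsymbol c;\mathsf D_i a$ for every $i$; (11) $\langle \mathsf D_1^n a\rangle;(a\sqcup b)=a$;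 (12) $\langle \mathsf A_1^n a\rangle;(a\sqcup b)=\langle \mathsf A_1^n a\rangle; b$.
   Context: Fix $n\ge 1$; indices $i,j,k$ range over $\{1,\dots,n\}$. The signature has an $(n+1)$-ary operation (composition), written $\langle a_1,\dots,a_n\rangle ; b$, unary operations $\mathsf A_1,\dots,\mathsf A_n$, and a binary operation $\sqcup$. Algebras are nonempty. An $n$-ary partial function on a set $X$ is a set $f\subseteq X^{n+1}$ such that $(\boldsymbol x,y),(\boldsymbol x,z)\in f$ implies $y=z$ (where $\boldsymbol x\in X^n$); it is injective if $(\boldsymbol x,z),(\boldsymbol y,z)\in f$ implies $\boldsymbol x=\boldsymbol y$. An algebra of $n$-ary partial functions of this signature is an algebra whose elements are $n$-ary partial functions, for which there are a set $X$ (the base) and an equivalence relation $E$ on $X$ such that every tuple $(x_1,\dots,x_{n+1})$ in every element lies in $X^{n+1}$ and has pairwise $E$-equivalent entries, and whose operations are $\boldsymbol f; g=\{(\boldsymbol x,z)\in X^{n+1} : \exists \boldsymbol y\in X^n,\ (\boldsymbol x,y_i)\in f_i \text{ for each } i \text{ and } (\boldsymbol y,z)\in g\}$, $\mathsf A_i(f)=\{(\boldsymbol x,x_i)\in X^{n+1} : x_1,\dots,x_n \text{ all } E\text{-equivalent and there is no } y\in X \text{ with } (\boldsymbol x,y)\in f\}$, and preferential union: $(f\sqcup g)(\boldsymbol x)$ is $f(\boldsymbol x)$ if $f(\boldsymbol x)$ is defined, $g(\boldsymbol x)$ if $f(\boldsymbol x)$ is undefined but $g(\boldsymbol x)$ is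 defined, and undefined otherwise. An algebra is representable by injective $n$-ary partial functions if it is isomorphic to an algebra of $n$-ary partial functions of the same signature all of whose elements are injective. Notation: a bold symbol $\boldsymbol a$ in a term $\boldsymbol a; b$ stands for $\langle a_1,\dots,a_n\rangle$; unbracketed compositions associate to the right ($\boldsymbol a;\boldsymbol b; c=\boldsymbol a;(\boldsymbol b; c)$); for unary operations $\mathsf B_1,\dots,\mathsf B_n$, $\langle \mathsf B_1^n a\rangle$ means $\langle \mathsf B_1 a,\dots,\mathsf B_n a\rangle$. Abbreviations: $0:=\langle \mathsf A_1^n b\rangle; b$ for any $b$; $\pi_i:=\mathsf A_i 0$; $\boldsymbol\pi:=\langle\pi_1,\dots,\pi_n\rangle$; $\mathsf D_i a:=\mathsf A_i\mathsf A_i a$. *)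

(* Defs.v *)
From Stdlib Require Import RelationClasses.
From Stdlib Require List.
From mathcomp Require Import all_boot.

Set Implicit Arguments.
Unset Strict Implicit.
Unset Printing Implicit Defensive.

(* n-tuples are families ['I_n -> T] throughout; equality of families is only
   extensional under functional extensionality. *)
Record algebra (n : nat) := Algebra {
  carrier :> Type;
  acomp : ('I_n -> carrier) -> carrier -> carrier;
  aanti : 'I_n -> carrier -> carrier;
  apref : carrier -> carrier -> carrier;
  algebra_nonempty : inhabited carrier }.

Arguments acomp {n} _ _ _.
Arguments aanti {n} _ _ _.
Arguments apref {n} _ _ _.

Definition is_hom (n : nat) (A B : algebra n) (h : A -> B) : Prop :=
  [/\ forall (a : 'I_n -> A) (b : A),
        h (acomp A a b) = acomp B (fun i => h (a i)) (h b),
      forall (i : 'I_n) (a : A), h (aanti A i a) = aanti B i (h a)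
    & forall a b : A, h (apref A a b) = apref B (h a) (h b)].

Definition isomorphic (n : nat) (A B : algebra n) : Prop :=
  exists2 h : A -> B, bijective h & is_hom h.

(* A subset of X^{n+1}, as a relation between X^n and X. *)
Definition nrel (n : nat) (X : Type) : Type := ('I_n -> X) -> X -> Prop.

Definition is_pfun (n : nat) (X : Type) (f : nrel n X) : Prop :=
  forall x y z, f x y -> f x z -> y = z.

Definition is_injective (n : nat) (X : Type) (f : nrel n X) : Prop :=
  forall x y z, f x z -> f y z -> x = y.

Definition all_related (n : nat) (X : Type) (E : X -> X -> Prop)
    (x : 'I_n -> X) : Prop :=
  forall i j, E (x i) (x j).

Definition respects (n : nat) (X : Type) (E : X -> X -> Prop)
    (f : nrel n X) : Prop :=
  forall x y, f x y -> all_related E x /\ forall i, E (x i) y.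

Definition rcomp (n : nat) (X : Type) (f : 'I_n -> nrel n X) (g : nrel n X) :
    nrel n X :=
  fun x z => exists2 y : 'I_n -> X, forall i, f i x (y i) & g y z.

Definition ranti (n : nat) (X : Type) (E : X -> X -> Prop) (i : 'I_n)
    (f : nrel n X) : nrel n X :=
  fun x z => [/\ z = x i, all_related E x & ~ exists y, f x y].

Definition rpref (n : nat) (X : Type) (f g : nrel n X) : nrel n X :=
  fun x z => f x z \/ (~ exists y, f x y) /\ g x z.

(* The base may be empty: the one-element algebra is only representable over
   the empty base. *)
Record pfun_algebra (n : nat) := PfunAlgebra {
  base : Type;
  brel : base -> base -> Prop;
  brel_equivalence : Equivalence brel;
  elements : nrel n base -> Prop;
  elements_pfun : forall f, elements f -> is_pfun f;
  elements_respects : forall f, elements f -> respects brel f;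
  elements_comp : forall (f : 'I_n -> nrel n base) (g : nrel n base),
    (forall i, elements (f i)) -> elements g -> elements (rcomp f g);
  elements_anti : forall (i : 'I_n) (f : nrel n base),
    elements f -> elements (ranti brel i f);
  elements_pref : forall f g : nrel n base,
    elements f -> elements g -> elements (rpref f g);
  elements_nonempty : inhabited {f : nrel n base | elements f} }.

Definition algebra_of_pfuns (n : nat) (P : pfun_algebra n) : algebra n :=
  @Algebra n {f : nrel n (base P) | elements f}
    (fun f g => exist _ (rcomp (fun i => sval (f i)) (sval g))
                  (elements_comp (fun i => svalP (f i)) (svalP g)))
    (fun i f => exist _ (ranti (@brel n P) i (sval f))
                  (elements_anti i (svalP f)))
    (fun f g => exist _ (rpref (sval f) (sval g))
                  (elements_pref (svalP f) (svalP g)))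
    (elements_nonempty P).

Definition injectively_representable (n : nat) (A : algebra n) : Prop :=
  exists P : pfun_algebra n,
    (forall f, @elements n P f -> is_injective f) /\
    isomorphic A (algebra_of_pfuns P).

(* The variables are named by pairs of naturals, so that [Var k 0], [Var k 1],
   ... can serve as the entries of a tuple of variables. *)
Inductive term (n : nat) : Type :=
| Var of nat & nat
| Comp of ('I_n -> term n) & term n
| Anti of 'I_n & term n
| Pref of term n & term n.

Arguments Var {n} _ _.

Fixpoint eval (n : nat) (A : algebra n) (v : nat -> nat -> A) (t : term n) : A :=
  match t with
  | Var k m => v k m
  | Comp s u => acomp A (fun i => eval v (s i)) (eval v u)
  | Anti i s => aanti A i (eval v s)
  | Pref s u => apref A (eval v s) (eval v u)
  end.

Record equation (n : nat) := Equation { lhs : term n; rhs : term n }.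

Record quasiequation (n : nat) := Quasiequation {
  premises : seq (equation n);
  conclusion : equation n }.

Definition holds_at (n : nat) (A : algebra n) (v : nat -> nat -> A)
    (e : equation n) : Prop :=
  eval v (lhs e) = eval v (rhs e).

Definition satisfies (n : nat) (A : algebra n) (q : quasiequation n) : Prop :=
  forall v : nat -> nat -> A,
    (forall e, List.In e (premises q) -> holds_at v e) ->
    holds_at v (conclusion q).

Definition axiomatised_by (n : nat) (K : algebra n -> Prop)
    (G : quasiequation n -> Prop) : Prop :=
  forall A : algebra n, K A <-> forall q, G q -> satisfies A q.

Definition quasivariety (n : nat) (K : algebra n -> Prop) : Prop :=
  exists G : quasiequation n -> Prop, axiomatised_by K G.

Definition finitely_axiomatised_by (n : nat) (K : algebra n -> Prop)
    (s : seq (quasiequation n)) : Prop :=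
  axiomatised_by K (fun q => List.In q s).

Declare Scope nterm_scope.
Delimit Scope nterm_scope with nterm.
Bind Scope nterm_scope with term.
Notation "s ;; t" := (Comp s t) (at level 60, right associativity) :
  nterm_scope.
Notation "s ≈ t" := (Equation s t) (at level 70, no associativity) :
  nterm_scope.
Local Open Scope nterm_scope.

Definition Law (n : nat) (e : equation n) : quasiequation n :=
  Quasiequation [::] e.

Definition va {n : nat} : term n := Var 0 0.
Definition vb {n : nat} : term n := Var 1 0.
Definition vc {n : nat} : term n := Var 2 0.
Definition ta {n : nat} (i : 'I_n) : term n := Var 3 i.
Definition tb {n : nat} (i : 'I_n) : term n := Var 4 i.
Definition tc {n : nat} (i : 'I_n) : term n := Var 5 i.

(* [As t] and [Ds t] are the tuples <A_1 t, ..., A_n t> and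
   <D_1 t, ..., D_n t>. *)
Definition As (n : nat) (t : term n) (i : 'I_n) : term n := Anti i t.
Definition Ds (n : nat) (t : term n) (i : 'I_n) : term n := Anti i (Anti i t).

(* Algebras have no constant, so 0 is the term <A_1 b, ..., A_n b> ; b for a
   variable b that has no other use; [ax3] makes the choice of b
   irrelevant. *)
Definition zero {n : nat} : term n := let b := Var 6 0 in As b ;; b.

Definition proj {n : nat} (i : 'I_n) : term n := Anti i zero.

Definition ax1 (n : nat) : quasiequation n :=
  Law ((fun i => ta ;; tb i) ;; vc ≈ ta ;; tb ;; vc).

Definition ax2 (n : nat) : quasiequation n :=
  Law (proj ;; va ≈ va).

Definition ax3 (n : nat) : quasiequation n :=
  Law (As va ;; va ≈ As vb ;; vb).

Definition ax4 (n : nat) (i : 'I_n) : quasiequation n :=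
  Law ((fun j => if j == i then zero else ta j) ;; vb ≈ zero).

Definition ax5 (n : nat) : quasiequation n :=
  Law (ta ;; zero ≈ zero).

(* [enum 'I_n] is increasing, so the fold is
   <D a_1> ; (<D a_2> ; ... (<D a_n> ; a_i)). *)
Definition ax6 (n : nat) (i : 'I_n) : quasiequation n :=
  Law (ta ;; Anti i vb ≈
       As (ta ;; vb) ;; foldr (fun j t => Ds (ta j) ;; t) (ta i) (enum 'I_n)).

Definition ax7 (n : nat) : quasiequation n :=
  Quasiequation [:: Ds va ;; vb ≈ Ds va ;; vc; As va ;; vb ≈ As va ;; vc]
    (vb ≈ vc).

Definition ax8 (n : nat) : quasiequation n :=
  Law (Ds va ;; va ≈ va).

Definition ax9 (n : nat) (i j k : 'I_n) : quasiequation n :=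
  Law (Anti i (Anti j va) ≈ Anti i (Anti k va)).

Definition ax10 (n : nat) (i : 'I_n) : quasiequation n :=
  Quasiequation [:: tb ;; va ≈ tc ;; va]
    (tb ;; Anti i (Anti i va) ≈ tc ;; Anti i (Anti i va)).

Definition ax11 (n : nat) : quasiequation n :=
  Law (Ds va ;; Pref va vb ≈ va).

Definition ax12 (n : nat) : quasiequation n :=
  Law (As va ;; Pref va vb ≈ As va ;; vb).

Definition axioms (n : nat) : seq (quasiequation n) :=
  [:: ax1 n; ax2 n; ax3 n] ++
  [seq ax4 i | i <- enum 'I_n] ++
  [:: ax5 n] ++
  [seq ax6 i | i <- enum 'I_n] ++
  [:: ax7 n; ax8 n] ++
  [seq ax9 p.1.1 p.1.2 p.2 | p <- enum {: 'I_n * 'I_n * 'I_n}] ++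
  [seq ax10 i | i <- enum 'I_n] ++
  [:: ax11 n; ax12 n].

(* Main.v *)
Require Import Defs.
From Stdlib Require List.
From mathcomp Require Import all_boot boolp classical_sets.

(** Soundness is a computation with relations: [anti f] and [dom f] act on the
    left as restrictions to the complement and to the domain of [f], and the
    only law that needs injectivity is [comp_dom_inj], where the common value
    of [b ;; a] and [c ;; a] at a point determines the tuple fed into [a].

    For completeness, think of the elements as functions of one unknown
    argument tuple and of a set [I] of elements as a guess of which elements
    are undefined there.  Restricting by [anti c] for finitely many [c] in [I]
    costs nothing at that argument, so two elements that agree after such a
    restriction must take the same value: this is [sim I].  A guess that
    decides every element and contains all that is locally 0 is a prime ideal
    ([prime]).  The laws make the restrictions
    idempotent ([anti_idem]) and commuting ([anti_comm]), so finite lists of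
    restrictions behave as the meets of a Boolean algebra, and no such algebra
    has to be built.  By Zorn's lemma and the case law [eq_of_cases], any two
    distinct elements are told apart by some prime ideal ([exists_prime]).

    Each prime ideal [I] yields a representation on the [sim I]-classes of the
    elements outside [I]: an element [x] sends the classes of [a_1, ..., a_n]
    to the class of [a ;; x], and is undefined if [a ;; x] lies in [I].  The
    disjoint union over all prime ideals, whose summands are the blocks of the
    equivalence relation, is faithful.  Antidomain and preferential union are
    respected because at a prime ideal either [a ;; x] is undefined, and
    [a ;; anti x i] is locally [a i], or it is defined, and [a ;; dom x i] is
    locally [a i] ([sim_comp_anti], [sim_comp_dom]).  The latter together with
    [comp_dom_inj] also gives injectivity: from [a ;; x] and [b ;; x] locally
    equal and defined one gets [a ;; dom x i] and [b ;; dom x i] locally equal,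
    that is, [a i] and [b i] ([sim_comp_inj]). *)

Set Implicit Arguments.
Unset Strict Implicit.
Unset Printing Implicit Defensive.

Declare Scope alg_scope.
Local Notation "s ;; t" := (acomp _ s t) : alg_scope.
Local Open Scope alg_scope.

(** * The axioms as statements about elements *)

Definition anti (n : nat) (A : algebra n) (c : A) (i : 'I_n) : A :=
  aanti A i c.

Definition dom (n : nat) (A : algebra n) (c : A) (i : 'I_n) : A :=
  aanti A i (aanti A i c).

(** The parameter [z] is the constant 0, which [anti_self] determines; then
    [anti z] is the tuple of projections. *)
Record laws (n : nat) (A : algebra n) (z : A) : Prop := Laws {
  compA : forall (a b : 'I_n -> A) c, (fun i => a ;; b i) ;; c = a ;; b ;; c;
  comp_proj : forall a, anti z ;; a = a;
  anti_self : forall a : A, anti a ;; a = z;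
  comp_zero_at : forall i (a : 'I_n -> A) b,
    (fun j => if j == i then z else a j) ;; b = z;
  comp_zero : forall a, a ;; z = z;
  comp_anti : forall i (a : 'I_n -> A) b,
    a ;; anti b i =
    anti (a ;; b) ;; foldr (fun j (t : A) => dom (a j) ;; t) (a i) (enum 'I_n);
  eq_of_cases : forall a b c : A,
    dom a ;; b = dom a ;; c -> anti a ;; b = anti a ;; c -> b = c;
  dom_self : forall a : A, dom a ;; a = a;
  anti_anti : forall i j k (a : A), anti (aanti A j a) i = anti (aanti A k a) i;
  comp_dom_inj : forall i (b c : 'I_n -> A) a,
    b ;; a = c ;; a -> b ;; dom a i = c ;; dom a i;
  dom_pref : forall a b : A, dom a ;; apref A a b = a;
  anti_pref : forall a b : A, anti a ;; apref A a b = anti a ;; b }.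

Section Quasiequations.
Variables (n : nat) (A : algebra n).

(** The lemmas on [satisfies_all] are equalities of propositions so that they
    can take the list [axioms n] apart by rewriting. *)
Definition satisfies_all (s : seq (quasiequation n)) : Prop :=
  forall q, List.In q s -> satisfies A q.

Lemma satisfies_nil : satisfies_all [::] = True.
Proof. by apply: propext; split=> // _ q []. Qed.

Lemma satisfies_cons q s :
  satisfies_all (q :: s) = (satisfies A q /\ satisfies_all s).
Proof.
apply: propext; split=> [H|[Hq Hs] r [<- //|]]; last exact: Hs.
by split=> [|r Hr]; apply: H; [left|right].
Qed.

Lemma satisfies_cat s t :
  satisfies_all (s ++ t) = (satisfies_all s /\ satisfies_all t).
Proof.
elim: s => [|q s IH] /=; first by rewrite satisfies_nil; apply: propext; tauto.
by rewrite !satisfies_cons IH; apply: propext; tauto.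
Qed.

Lemma satisfies_enum (T : finType) (f : T -> quasiequation n) :
  satisfies_all [seq f i | i <- enum T] = forall i, satisfies A (f i).
Proof.
have {1}-> : satisfies_all [seq f i | i <- enum T] =
             forall i, i \in enum T -> satisfies A (f i).
  elim: (enum T) => [|j s IH] /=.
    by rewrite satisfies_nil; apply: propext; split.
  rewrite satisfies_cons IH; apply: propext; split=> [[Hj Hs] i|H].
    by rewrite inE => /predU1P[->//|]; apply: Hs.
  by split=> [|i Hi]; apply: H; rewrite inE ?eqxx ?Hi ?orbT.
by apply: propext; split=> H i; [apply: H; rewrite mem_enum|move=> _; apply: H].
Qed.

(** Tuples of variables are numbered by all naturals; [d] pads a tuple of
    elements. *)
Definition pad (d : A) (a : 'I_n -> A) (m : nat) : A :=
  oapp a d (insub m).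

Lemma padE d a (i : 'I_n) : pad d a i = a i.
Proof. by rewrite /pad valK. Qed.

Definition valuation (d x y w : A) (a b c : 'I_n -> A) (k m : nat) : A :=
  match k with
  | 0 => x | 1 => y | 2 => w
  | 3 => pad d a m | 4 => pad d b m | 5 => pad d c m
  | _ => d
  end.

Lemma eval_foldr (v : nat -> nat -> A) (t : 'I_n -> term n) u s :
  eval v (foldr (fun j r => Comp (Ds (t j)) r) u s) =
  foldr (fun j (r : A) => dom (eval v (t j)) ;; r) (eval v u) s.
Proof. by elim: s => //= j s ->. Qed.

Lemma eval_if (v : nat -> nat -> A) (b : bool) t u :
  eval v (if b then t else u) = if b then eval v t else eval v u.
Proof. by case: b. Qed.

Lemma lawsP : (exists z : A, laws z) <-> satisfies_all (axioms n).
Proof.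
rewrite /axioms !(satisfies_cat, satisfies_cons, satisfies_nil, satisfies_enum).
split=> [[z L]|].
  have zE (v : nat -> nat -> A) : eval v Defs.zero = z.
    by rewrite /= -(anti_self L (v 6 0)).
  have zE' (v : nat -> nat -> A) :
      (fun i => aanti A i (eval v Defs.zero)) = anti z by rewrite zE.
  repeat split.
  - by move=> v _; exact: (compA L).
  - by move=> v _; rewrite /holds_at /lhs /rhs [LHS]/= zE' (comp_proj L).
  - by move=> v _; rewrite /holds_at /= !(anti_self L).
  - move=> i v _; rewrite /holds_at /lhs /rhs zE /=.
    rewrite -[RHS](comp_zero_at L i (fun j => v 3 j) (v 1 0)).
    by congr acomp; apply: funext => j; rewrite eval_if zE.
  - move=> v _.
    change ((fun i : 'I_n => v 3 i) ;; eval v Defs.zero = eval v Defs.zero).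
    by rewrite zE (comp_zero L).
  - by move=> i v _; rewrite /holds_at /= eval_foldr; exact: (comp_anti L).
  - move=> v H; apply: (@eq_of_cases _ _ _ L (v 0 0)).
      by apply: (H _ (or_introl erefl)).
    by apply: (H _ (or_intror (or_introl erefl))).
  - by move=> v _; exact: (dom_self L).
  - by case=> [[i j] k] v _; exact: (anti_anti L).
  - by move=> i v H; apply: (comp_dom_inj L); apply: (H _ (or_introl erefl)).
  - by move=> v _; exact: (dom_pref L).
  - by move=> v _; exact: (anti_pref L).
move=> [[H1 [H2 [H3 _]]] [H4 [[H5 _] [H6 [[H7 [H8 _]] H9_12]]]]].
move: H9_12 => [H9 [H10 [H11 [H12 _]]]].
have [d] := algebra_nonempty A; pose z := anti d ;; d.
pose V := valuation d.
pose c0 (i : 'I_n) := d.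
have famE (a : 'I_n -> A) : (fun i : 'I_n => pad d a i) = a.
  by apply: funext => i; rewrite padE.
exists z; split.
- move=> a b c; have := H1 (V d d c a b c0);
  rewrite /holds_at /= !famE => <- //.
  by congr acomp; apply: funext => i; rewrite padE.
- by move=> a; exact: (H2 (V a d d c0 c0 c0)).
- by move=> a; exact: (H3 (V a d d c0 c0 c0)).
- move=> i a b; apply: etrans (H4 i (V d b d a c0 c0) _) => //=.
  by congr acomp; apply: funext => j; rewrite eval_if /= padE.
- by move=> a; have := H5 (V d d d a c0 c0); rewrite /holds_at /= famE; apply.
- move=> i a b; have := H6 i (V d b d a c0 c0).
  rewrite /holds_at /= eval_foldr /= padE famE => -> //.
  by congr acomp; congr foldr; apply: funext => j; rewrite padE.
- by move=> a b c e1 e2; apply: (H7 (V a b c c0 c0 c0)) => e /= [<-|[<-|]].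
- by move=> a; exact: (H8 (V a d d c0 c0 c0)).
- by move=> i j k a; exact: (H9 (i, j, k) (V a d d c0 c0 c0)).
- move=> i b c a e; have := H10 i (V a d d c0 b c).
  by rewrite /holds_at /= !famE; apply=> _ [<-|//]; rewrite /holds_at /= !famE.
- by move=> a b; exact: (H11 (V a b d c0 c0 c0)).
- by move=> a b; exact: (H12 (V a b d c0 c0 c0)).
Qed.

End Quasiequations.

Section Isomorphism.
Variables (n : nat) (A B : algebra n) (h : A -> B).
Hypotheses (h_bij : bijective h) (h_hom : is_hom h).

Lemma eval_hom v t : h (eval v t) = eval (fun k m => h (v k m)) t.
Proof.
case: h_hom => hC hA hP.
elim: t => [//|s IHs u IHu|i s IHs|s IHs u IHu] /=.
- by rewrite hC IHu; congr acomp; apply: funext.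
- by rewrite hA IHs.
- by rewrite hP IHs IHu.
Qed.

Lemma satisfies_iso q : satisfies B q -> satisfies A q.
Proof.
move=> Bq v pv; apply: (bij_inj h_bij); rewrite !eval_hom; apply: Bq => e eq.
by rewrite /holds_at -!eval_hom (pv _ eq).
Qed.

End Isomorphism.

(** * Injective partial functions satisfy the laws *)

Definition defined (n : nat) (X : Type) (f : nrel n X) x : Prop :=
  exists y, f x y.

Lemma sval_inj (n : nat) (P : pfun_algebra n) :
  injective (fun f : algebra_of_pfuns P => sval f).
Proof. by move=> [f Hf] [g Hg] /= fg; apply: eq_exist. Qed.

Section Soundness.
Variables (n : nat) (P : pfun_algebra n).
Hypothesis n_gt0 : 0 < n.
Hypothesis P_inj : forall f, @elements n P f -> is_injective f.

Local Notation B := (algebra_of_pfuns P).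
Local Notation rel := (all_related (@brel n P)).

Lemma sval_eq (f g : B) : (forall x y, sval f x y <-> sval g x y) -> f = g.
Proof.
move=> fg; apply: sval_inj; apply: funext => x; apply: funext => y.
exact: propext.
Qed.

Lemma sval_pfun (f : B) : is_pfun (sval f).
Proof. exact: elements_pfun (svalP f). Qed.

Lemma sval_related (f : B) x y : sval f x y -> rel x.
Proof. by move/(elements_respects (svalP f)) => []. Qed.

Lemma sval_anti (f : B) (i : 'I_n) x y :
  sval (anti f i) x y <-> [/\ y = x i, rel x & ~ defined (sval f) x].
Proof. by []. Qed.

(** Composing with [anti f] on the left restricts to the complement of the
    domain of [f]: the intermediate tuple can only be the argument itself.  For
    [n = 0] the empty tuple [anti f] would restrict nothing. *)
Lemma sval_anti_comp (f g : B) x y :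
  sval (anti f ;; g) x y <-> ~ defined (sval f) x /\ sval g x y.
Proof.
split=> [[w /= fw gw]|[fx gx]].
  have wx : w = x by apply: funext => i; have [] := fw i.
  by split; [have [] := fw (Ordinal n_gt0)|rewrite -wx].
by exists x => // i; apply/sval_anti; split=> //; apply: sval_related gx.
Qed.

Lemma defined_anti (f : B) (i : 'I_n) x :
  defined (sval (anti f i)) x <-> rel x /\ ~ defined (sval f) x.
Proof. by split=> [[y /sval_anti[]]|[]] //; exists (x i); apply/sval_anti. Qed.

Lemma sval_dom (f : B) (i : 'I_n) x y :
  sval (dom f i) x y <-> y = x i /\ defined (sval f) x.
Proof.
rewrite (_ : dom f i = anti (anti f i) i) // sval_anti.
rewrite (propext (defined_anti _ _ _)).
split=> [[-> rx nfx]|[-> [w fx]]].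
  by split=> //; apply: contrapT => nf; apply: nfx.
have rx := sval_related fx.
by split=> // -[_]; apply; exists w.
Qed.

Lemma sval_dom_comp (f g : B) x y :
  sval (dom f ;; g) x y <-> defined (sval f) x /\ sval g x y.
Proof.
split=> [[w /= fw gw]|[fx gx]].
  have wx : w = x by apply: funext => i; have /sval_dom[] := fw i.
  by split; [have /sval_dom[] := fw (Ordinal n_gt0)|rewrite -wx].
by exists x => // i; apply/sval_dom.
Qed.

Lemma sval_foldr_dom (a : 'I_n -> B) (f : B) s x y :
  sval (foldr (fun j (t : B) => dom (a j) ;; t) f s) x y <->
  (forall j, j \in s -> defined (sval (a j)) x) /\ sval f x y.
Proof.
elim: s => [|j s IH]; first by split=> [|[]].
rewrite -[foldr _ _ _]/(dom (a j) ;; foldr (fun i t => dom (a i) ;; t) f s).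
rewrite sval_dom_comp IH; split=> [[ax [H fx]]|[H fx]].
  by split=> // i; rewrite inE => /predU1P[->//|]; apply: H.
split; first by apply: H; rewrite inE eqxx.
by split=> // i Hi; apply: H; rewrite inE Hi orbT.
Qed.

Lemma exists_values (a : 'I_n -> B) x :
  (forall j, defined (sval (a j)) x) ->
  exists w : 'I_n -> base P, forall j, sval (a j) x (w j).
Proof. by move=> H; exists (fun j => sval (cid (H j))) => j; case: cid. Qed.

(** All values are related to the first entry of the argument. *)
Lemma values_related (a : 'I_n -> B) x w :
  (forall j, sval (a j) x (w j)) -> rel w.
Proof.
move=> aw i j; have E := brel_equivalence P; pose o := Ordinal n_gt0.
have [_ /(_ o) Ei] := elements_respects (svalP (a i)) (aw i).
have [_ /(_ o) Ej] := elements_respects (svalP (a j)) (aw j).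
by apply: (RelationClasses.Equivalence_Transitive _ (x o));
  [apply: RelationClasses.Equivalence_Symmetric|].
Qed.

Lemma laws_pfuns : exists z : B, laws z.
Proof.
have [d] := algebra_nonempty B; pose z := anti d ;; d; exists z.
have zE x y : ~ sval z x y.
  by move/sval_anti_comp => [nd dx]; apply: nd; exists y.
split.
- (* A single intermediate tuple [v] serves all the [b i], as the [a j] are
     single-valued. *)
  move=> a b c; apply: sval_eq => x y; split=> [[w /= H cw]|[w aw [u bu cu]]].
    have aD j : defined (sval (a j)) x.
      by have [v av _] := H (Ordinal n_gt0); exists (v j); apply: av.
    have [v av] := exists_values aD.
    exists v => //; exists w => // i; have [v' av' bv'] := H i.
    suff -> : v = v' by [].
    by apply: funext => j; apply: sval_pfun (av j) (av' j).
  by exists u => // i; exists w.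
- move=> a; apply: sval_eq => x y; rewrite sval_anti_comp.
  by split=> [[]|ax] //; split=> // -[w /zE].
- move=> a; apply: sval_eq => x y; rewrite sval_anti_comp.
  by split=> [[na ax]|/zE//]; case: na; exists y.
- move=> i a b; apply: sval_eq => x y; split=> [[w /= /(_ i)]|/zE//].
  by rewrite eqxx => /zE.
- by move=> a; apply: sval_eq => x y; split=> [[w _ /zE]|/zE].
- move=> i a b; apply: sval_eq => x y; rewrite sval_anti_comp sval_foldr_dom.
  split=> [[w aw /sval_anti[-> rw nb]]|[nab [aD ax]]].
    split; last by split=> [j _|]; [exists (w j); apply: aw|apply: aw].
    move=> [v [w' aw' bw']]; apply: nb; exists v.
    rewrite (_ : w = w') //; apply: funext => j.
    by apply: sval_pfun (aw j) (aw' j).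
  have [|w aw] := @exists_values a x.
    by move=> j; apply: aD; rewrite mem_enum.
  exists w => //; apply/sval_anti; split; first exact: sval_pfun ax (aw i).
    exact: values_related aw.
  by move=> [v bv]; apply: nab; exists v, w.
- move=> a b c /(f_equal sval) bcD /(f_equal sval) bcA; apply: sval_eq => x y.
  have [ax|nax] := EM (defined (sval a) x).
    have := sval_dom_comp a b x y; rewrite bcD sval_dom_comp; tauto.
  have := sval_anti_comp a b x y; rewrite bcA sval_anti_comp; tauto.
- move=> a; apply: sval_eq => x y; rewrite sval_dom_comp.
  by split=> [[]|ax] //; split=> //; exists y.
- move=> i j k a; apply: sval_eq => x y.
  by rewrite !sval_anti !(propext (defined_anti _ _ _)).
- move=> i b c a /(f_equal sval) bca; apply: sval_eq => x y.
  (* The common value of [b ;; a] and [c ;; a] has only one preimage. *)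
  have half (b' c' : 'I_n -> B) : sval (b' ;; a) = sval (c' ;; a) ->
      sval (b' ;; dom a i) x y -> sval (c' ;; dom a i) x y.
    move=> e [w bw /sval_dom[-> [v av]]].
    have : sval (b' ;; a) x v by exists w.
    rewrite e => -[w' cw' av'].
    have ww' : w = w' := P_inj (svalP a) av av'.
    by exists w => [|]; [rewrite ww'|apply/sval_dom; split=> //; exists v].
  by split; apply: half.
- move=> a b; apply: sval_eq => x y; rewrite sval_dom_comp.
  split=> [[aD [//|[]//]]|ax]; split; [by exists y|by left].
- move=> a b; apply: sval_eq => x y; rewrite !sval_anti_comp.
  split=> [[aD [ax|[]//]]|[aD bx]]; first by case: aD; exists y.
  by split=> //; right.
Qed.

End Soundness.

(** * Restrictions commute and are idempotent *)

Section Completeness.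
Variables (n : nat) (A : algebra n) (z : A).
Hypotheses (n_gt0 : 0 < n) (L : laws z).
Implicit Types (a b : 'I_n -> A) (c d x y : A) (s t : seq A).

Lemma zero_comp x : (fun=> z) ;; x = z.
Proof.
rewrite -[RHS](comp_zero_at L (Ordinal n_gt0) (fun=> z) x).
by congr acomp; apply: funext => j; case: ifP.
Qed.

Lemma domE c i : dom c = anti (aanti A i c).
Proof. by apply: funext => j; exact: (anti_anti L). Qed.

(** In [comp_anti] for the tuple [anti c], all the factors [dom (anti c j)]
    coincide by [anti_anti], so that [dom_self] absorbs them. *)
Lemma anti_comp_anti c d i :
  anti c ;; anti d i = anti (anti c ;; d) ;; anti c i.
Proof.
rewrite (comp_anti L); congr acomp.
elim: (enum _) => //= j s ->.
rewrite (_ : dom (anti c j) = dom (anti c i)) ?(dom_self L) //.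
by apply: funext => k; congr (aanti A k _); exact: (anti_anti L).
Qed.

Lemma anti_slide c d x :
  anti c ;; anti d ;; x = anti (anti c ;; d) ;; anti c ;; x.
Proof.
rewrite -!(compA L); congr acomp; apply: funext => i.
exact: anti_comp_anti.
Qed.

Lemma anti_idem c x : anti c ;; anti c ;; x = anti c ;; x.
Proof. by rewrite anti_slide (anti_self L) (comp_proj L). Qed.

Lemma dom_anti c x : dom c ;; anti c ;; x = z.
Proof.
rewrite -(compA L) -[RHS](zero_comp x); congr acomp; apply: funext => i.
by rewrite (domE c i) (anti_self L).
Qed.

(** By [eq_of_cases] on [c]: off the domain of [c] both sides become
    [anti c ;; anti d ;; x] by [anti_slide] and idempotence; on it both vanish,
    since [dom c] is itself an [anti] and so can be slid past [anti d]. *)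
Lemma anti_comm c d x : anti c ;; anti d ;; x = anti d ;; anti c ;; x.
Proof.
apply: (@eq_of_cases _ _ _ L c).
  by rewrite dom_anti (domE c (Ordinal n_gt0)) anti_slide -(domE c) dom_anti
    (comp_zero L).
by rewrite anti_idem [RHS]anti_slide anti_idem anti_slide.
Qed.

(** A list stands for the meet of the corresponding restrictions. *)
Definition restrict s x : A := foldr (fun c (t : A) => anti c ;; t) x s.

Lemma restrict_cat s t x : restrict (s ++ t) x = restrict s (restrict t x).
Proof. by rewrite /restrict foldr_cat. Qed.

Lemma restrict_comp s a x :
  restrict s (a ;; x) = (fun i => restrict s (a i)) ;; x.
Proof. by elim: s => //= c s ->; rewrite -(compA L). Qed.

Lemma restrict_zero s : restrict s z = z.
Proof. by elim: s => //= c s ->; rewrite (comp_zero L). Qed.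

Lemma restrict_anti s c x : restrict s (anti c ;; x) = anti c ;; restrict s x.
Proof. by elim: s => //= d s ->; rewrite anti_comm. Qed.

Lemma restrictC s t x : restrict s (restrict t x) = restrict t (restrict s x).
Proof. by elim: t => //= c t <-; rewrite restrict_anti. Qed.

(** If [x] vanishes under a restriction, then so does its domain: this is
    [comp_dom_inj] for the restricted tuple of projections and the tuple of
    zeros. *)
Lemma restrict_dom_zero s x y : restrict s x = z -> restrict s (dom x ;; y) = z.
Proof.
move=> sx.
have e : (fun i => restrict s (anti z i)) ;; x = (fun=> z) ;; x.
  by rewrite -restrict_comp (comp_proj L) sx zero_comp.
rewrite restrict_comp -[RHS](zero_comp y); congr acomp; apply: funext => i.
rewrite -[dom x i](comp_proj L) restrict_comp (comp_dom_inj L i e).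
exact: zero_comp.
Qed.

(** * Local equality and prime ideals *)

(** Equality at an argument where the elements of [I] are undefined. *)
Definition sim (I : set A) x y : Prop :=
  exists2 s, List.Forall I s & restrict s x = restrict s y.

Lemma sim_refl I x : sim I x x.
Proof. by exists [::]. Qed.

Lemma sim_sym I x y : sim I x y -> sim I y x.
Proof. by case=> s Is e; exists s. Qed.

Lemma Forall_cat (I : set A) s t :
  List.Forall I s -> List.Forall I t -> List.Forall I (s ++ t).
Proof. by elim=> //= c u Ic _ IH It; constructor=> //; apply: IH. Qed.

Lemma sim_trans I y x x' : sim I x y -> sim I y x' -> sim I x x'.
Proof.
move=> [s Is sxy] [t It tyx']; exists (s ++ t); first exact: Forall_cat.
by rewrite !restrict_cat -tyx' restrictC sxy restrictC.
Qed.

(** The lists witnessing the [n] hypotheses are concatenated. *)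
Lemma sim_comp I a b x :
  (forall i, sim I (a i) (b i)) -> sim I (a ;; x) (b ;; x).
Proof.
move=> ab.
have [s Is e] : exists2 s, List.Forall I s &
    forall i, i \in enum 'I_n -> restrict s (a i) = restrict s (b i).
  elim: (enum _) => [|i r [s Is e]]; first by exists [::].
  have [t It eti] := ab i; exists (s ++ t); first exact: Forall_cat.
  move=> j; rewrite inE !restrict_cat => /predU1P[->|/e esj].
    by rewrite eti.
  by rewrite !(restrictC s) esj.
exists s => //; rewrite !restrict_comp; congr acomp; apply: funext => i.
by apply: e; rewrite mem_enum.
Qed.

Lemma sim_anti I c x : I c -> sim I (anti c ;; x) x.
Proof.
by move=> Ic; exists [:: c]; [constructor|rewrite /= anti_idem].
Qed.

Lemma sim_zero I x : I x -> sim I x z.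
Proof.
move=> Ix; exists [:: x]; first by constructor.
by rewrite /= (anti_self L) (comp_zero L).
Qed.

(** [prime_or] makes [I] decide every element; [prime_closed] says that
    whatever is forced to be undefined is in [I].  The whole carrier is prime in
    this sense, but it contributes no point to the base below. *)
Record prime (I : set A) : Prop := Prime {
  prime_closed : forall x, sim I x z -> I x;
  prime_or : forall x i, I x \/ I (anti x i) }.

(** [sim] has finite character, which is what Zorn's lemma asks for. *)
Lemma Forall_bigcup (F : set (set A)) s :
  total_on F subset -> List.Forall (\bigcup_(X in F) X)%classic s ->
  s = [::] \/ exists2 X, F X & List.Forall X s.
Proof.
move=> Ftot; elim=> [|c t [X FX Xc] _ [->|[Y FY Yt]]]; first by left.
  by right; exists X => //; constructor.
right; have [XY|YX] := Ftot X Y FX FY.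
  by exists Y => //; constructor=> //; apply: XY.
by exists X => //; constructor=> //; apply: List.Forall_impl Yt; apply: YX.
Qed.

(** Commutation and idempotence merge all occurrences of the added element into
    one. *)
Lemma Forall_setU1 (I : set A) c s :
  List.Forall (I `|` [set c])%classic s ->
  exists2 t, List.Forall I t &
    forall x, anti c ;; restrict s x = anti c ;; restrict t x.
Proof.
elim=> [|e s' Ie _ [t It st]]; first by exists [::].
case: Ie => [Ie|->].
  by exists (e :: t) => [|x] /=; [constructor|rewrite !(anti_comm c e) st].
by exists t => // x; rewrite /= anti_idem st.
Qed.

(** Take [I] maximal with [x] and [y] not locally equal.  If neither [c] nor
    [anti c i] were in [I], adding the one would make [x] and [y] locally equal
    off the domain of [c], adding the other on it, and by [eq_of_cases] they
    would be locally equal for [I] itself.  If [c] vanishes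
    locally but is not in [I], then [anti c i] is in [I], so that [dom c] is a
    harmless restriction that kills everything, [x] and [y] included. *)
Lemma exists_prime x y : x <> y -> exists2 I, prime I & ~ sim I x y.
Proof.
move=> xy.
have [F FP Ftot|I [nI Imax]] := @Zorn_bigcup A (fun I => ~ sim I x y).
  case=> s /(Forall_bigcup Ftot)[->//|[X FX Xs]] e.
  by apply: (FP X FX); exists s.
have {}Imax c : ~ I c ->
    exists2 t, List.Forall I t &
      anti c ;; restrict t x = anti c ;; restrict t y.
  move=> Ic; have : sim (I `|` [set c])%classic x y.
    apply: contrapT; apply: Imax; split; first by left.
    by move=> sub; apply: Ic; apply: sub; right.
  by case=> s /Forall_setU1[t It st] e; exists t => //; rewrite -!st e.
have Ior c i : I c \/ I (anti c i).
  apply: contrapT => /not_orP[/Imax[s Is es] /Imax[t It et]]; apply: nI.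
  exists (s ++ t); first exact: Forall_cat.
  rewrite !restrict_cat; apply: (@eq_of_cases _ _ _ L c).
    by rewrite (domE c i) -!(restrict_anti s) et.
  by rewrite !(restrictC s t) -!(restrict_anti t) es.
exists I => //; split=> // c [s Is sc]; apply: contrapT => Ic; apply: nI.
have Idc : I (anti c (Ordinal n_gt0)) by have [] := Ior c (Ordinal n_gt0).
exists (rcons s (anti c (Ordinal n_gt0))).
  by rewrite -cats1; apply: Forall_cat => //; constructor.
by rewrite -cats1 !restrict_cat /= -!domE !restrict_dom_zero //
  sc restrict_zero.
Qed.

Section Prime.
Variables (I : set A).
Hypothesis Ip : prime I.

Lemma prime_sim x y : sim I x y -> I y -> I x.
Proof.
by move=> xy Iy; apply: (prime_closed Ip); apply: sim_trans xy (sim_zero Iy).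
Qed.

Lemma prime_comp a x i : I (a i) -> I (a ;; x).
Proof.
move=> Iai; apply: (prime_closed Ip).
rewrite -[z in sim _ _ z](comp_zero_at L i a x); apply: sim_comp => j.
by case: eqP => [->|_]; [apply: sim_zero|apply: sim_refl].
Qed.

(** [dom x] is [anti (anti x i)], and [anti x i] lies in [I] by primality. *)
Lemma sim_dom x y : ~ I x -> sim I (dom x ;; y) y.
Proof.
move=> Ix; rewrite (domE x (Ordinal n_gt0)); apply: sim_anti.
by case: (prime_or Ip x (Ordinal n_gt0)).
Qed.

(** Every factor in front of [a i] in [comp_anti] is locally the identity. *)
Lemma sim_comp_anti a x i :
  (forall j, ~ I (a j)) -> I (a ;; x) -> sim I (a ;; anti x i) (a i).
Proof.
move=> aI Iax; rewrite (comp_anti L); apply: sim_trans (sim_anti _ Iax) _.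
elim: (enum _) => [|j s IH] /=; first exact: sim_refl.
exact: sim_trans (sim_dom _ (aI j)) IH.
Qed.

(** [dom (a ;; x)] is locally the identity, but annihilates the first factor
    [anti (a ;; x)] in [comp_anti]. *)
Lemma prime_comp_anti a x i : ~ I (a ;; x) -> I (a ;; anti x i).
Proof.
move=> Iax; apply: (prime_closed Ip); rewrite (comp_anti L).
set y := foldr _ _ _; apply: sim_trans (sim_sym (sim_dom _ Iax)) _.
by rewrite dom_anti; apply: sim_refl.
Qed.

Lemma not_prime_comp a x : ~ I (a ;; x) -> forall i, ~ I (a i).
Proof. by move=> Iax i /prime_comp. Qed.

Lemma sim_comp_dom a x i : ~ I (a ;; x) -> sim I (a ;; dom x i) (a i).
Proof.
move=> Iax; apply: sim_comp_anti (not_prime_comp Iax) _.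
exact: prime_comp_anti.
Qed.

(** As [a] is locally [a ;; dom x], the law [dom_pref] applies after [a]. *)
Lemma sim_pref_l a x y : ~ I (a ;; x) -> sim I (a ;; apref A x y) (a ;; x).
Proof.
move=> Iax; rewrite -[X in sim _ _ (_ ;; X)](dom_pref L x y) -(compA L).
by apply: sim_comp => i; apply: sim_sym; apply: sim_comp_dom.
Qed.

Lemma sim_pref_r a x y :
  (forall j, ~ I (a j)) -> I (a ;; x) -> sim I (a ;; apref A x y) (a ;; y).
Proof.
move=> aI Iax; apply: (@sim_trans _ (a ;; anti x ;; y)).
  rewrite -(anti_pref L) -(compA L).
  by apply: sim_comp => i; apply: sim_sym; apply: sim_comp_anti.
by rewrite -(compA L); apply: sim_comp => i; apply: sim_comp_anti.
Qed.

(** The one use of [comp_dom_inj] at a prime ideal; it makes the functions of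
    the representation injective. *)
Lemma sim_comp_inj a b x :
  ~ I (a ;; x) -> sim I (a ;; x) (b ;; x) -> forall i, sim I (a i) (b i).
Proof.
move=> Iax ab i.
have Ibx : ~ I (b ;; x) by move/(prime_sim ab).
apply: sim_trans (sim_sym (sim_comp_dom i Iax)) _.
apply: sim_trans (sim_comp_dom i Ibx).
have [s Is] := ab; rewrite !restrict_comp => e; exists s => //.
by rewrite !restrict_comp; apply: (comp_dom_inj L).
Qed.

End Prime.

(** * The representation *)

(** A class is kept together with its ideal, so that points over different
    ideals are distinct. *)
Record point := Point {
  ideal : set A;
  class : set A;
  pointP : prime ideal /\ exists2 x, ~ ideal x & class = sim ideal x }.

Lemma ideal_prime p : prime (ideal p).
Proof. by case: (pointP p). Qed.

Lemma class_ex p : exists x, class p x.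
Proof. by have [_ [x _ ->]] := pointP p; exists x; apply: sim_refl. Qed.

Definition rep p : A := sval (cid (class_ex p)).

Lemma class_rep p : class p (rep p).
Proof. exact: svalP. Qed.

Lemma class_not_ideal p x : class p x -> ~ ideal p x.
Proof.
have [Ip [y Iy ->]] := pointP p => yx Ix; exact: Iy (prime_sim Ip yx Ix).
Qed.

Lemma classE p x : class p x -> class p = sim (ideal p) x.
Proof.
have [Ip [y Iy ->]] := pointP p => yx; apply: funext => w; apply: propext.
by split; apply: sim_trans => //; apply: sim_sym.
Qed.

Lemma class_sim p x y : class p x -> class p y -> sim (ideal p) x y.
Proof. by move/classE->. Qed.

Lemma sim_class p x y : class p x -> sim (ideal p) x y -> class p y.
Proof. by move/classE->. Qed.

Lemma point_eq p q x : ideal p = ideal q -> class p x -> class q x -> p = q.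
Proof.
move=> Ipq /classE px /classE qx; rewrite Ipq -qx in px.
case: p q Ipq px qx => [I C H] [J D K] /= e1 e2 _.
by subst; congr Point; apply: Prop_irrelevance.
Qed.

Lemma exists_point I x : prime I -> ~ I x ->
  exists p, ideal p = I /\ class p x.
Proof.
move=> Ip Ix; have H : prime I /\ exists2 y, ~ I y & sim I x = sim I y.
  by split=> //; exists x.
by exists (Point H); split=> //; apply: sim_refl.
Qed.

Lemma exists_points (I : set A) a : prime I -> (forall i, ~ I (a i)) ->
  exists p : 'I_n -> point, forall i, ideal (p i) = I /\ class (p i) (a i).
Proof.
move=> Ip aI; exists (fun i => sval (cid (exists_point Ip (aI i)))) => i.
by case: cid.
Qed.

Lemma rep_not_ideal p : ~ ideal p (rep p).
Proof. exact/class_not_ideal/class_rep. Qed.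

Definition same_ideal p q : Prop := ideal p = ideal q.

Lemma same_ideal_equivalence : RelationClasses.Equivalence same_ideal.
Proof. by rewrite /same_ideal; split=> [p|p q|p q r] // ->. Qed.

(** Membership of the value in the class [q] encodes definedness as well: a
    class is disjoint from its ideal. *)
Definition theta x : nrel n point := fun p q =>
  (forall i, same_ideal (p i) q) /\ class q ((fun i => rep (p i)) ;; x).

(** Independence of the choice of representatives. *)
Lemma thetaP x p q a :
  (forall i, same_ideal (p i) q) -> (forall i, class (p i) (a i)) ->
  theta x p q <-> class q (a ;; x).
Proof.
move=> pq pa.
have e : sim (ideal q) ((fun i => rep (p i)) ;; x) (a ;; x).
  apply: sim_comp => i; rewrite -(pq i).
  exact: class_sim (class_rep _) (pa i).
split=> [[_ H]|H]; first exact: sim_class H e.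
by split=> //; apply: sim_class H (sim_sym e).
Qed.

Let o : 'I_n := Ordinal n_gt0.

Lemma theta_defined x p :
  (exists q, theta x p q) <->
  all_related same_ideal p /\ ~ ideal (p o) ((fun i => rep (p i)) ;; x).
Proof.
split=> [[q [pq qx]]|[pr Ix]].
  split=> [i j|]; first by rewrite /same_ideal !pq.
  by rewrite (pq o); apply: class_not_ideal.
have [q [qI qx]] := exists_point (ideal_prime (p o)) Ix.
by exists q; split=> // i; rewrite /same_ideal qI; apply: pr.
Qed.

Lemma theta_pfun x : is_pfun (theta x).
Proof.
move=> p q r [pq qx] [pr rx]; apply: point_eq qx rx.
by rewrite -(pq o) (pr o).
Qed.

Lemma theta_injective x : is_injective (theta x).
Proof.
move=> p q r [pr rp] [qr rq]; apply: funext => i.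
have Iax := class_not_ideal rp.
have e := sim_comp_inj (ideal_prime r) Iax (class_sim rp rq) i.
apply: (@point_eq _ _ (rep (q i))); last exact: class_rep.
  by rewrite (pr i) (qr i).
by apply: sim_class (class_rep _) _; rewrite (pr i).
Qed.

Lemma theta_respects x : respects same_ideal (theta x).
Proof.
by move=> p q [pq _]; split=> // i j; rewrite /same_ideal (pq i) (pq j).
Qed.

Lemma theta_comp a x : theta (a ;; x) = rcomp (fun i => theta (a i)) (theta x).
Proof.
apply: funext => p; apply: funext => r; apply: propext; split.
  move=> [pr]; rewrite -(compA L) => rx; pose I := ideal r.
  have Ip : prime I := ideal_prime r.
  have [q qP] := exists_points Ip (not_prime_comp Ip (class_not_ideal rx)).
  exists q => [i|].
    have [qI qa] := qP i.
    by split=> // j; rewrite /same_ideal qI; apply: pr.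
  apply/thetaP; last exact: rx; first by move=> i; case: (qP i).
  by move=> i; case: (qP i).
move=> [q pq /[dup] qr [qI _]].
have pr i : same_ideal (p i) r by have [H _] := pq o; rewrite /same_ideal H qI.
split=> //; rewrite -(compA L); apply: (proj1 (thetaP x qI _) qr) => i.
by case: (pq i).
Qed.

Lemma theta_anti i x : theta (anti x i) = ranti same_ideal i (theta x).
Proof.
apply: funext => p; apply: funext => q; apply: propext.
set a := fun j => rep (p j).
split=> [[pq qx]|[-> pr /theta_defined nx]].
  have Iq := ideal_prime q.
  have aI := not_prime_comp Iq (class_not_ideal qx).
  have Iax : ideal q (a ;; x).
    apply: contrapT => /(prime_comp_anti Iq i); exact: class_not_ideal qx.
  split; last 2 first.
  - by move=> j k; rewrite /same_ideal !pq.
  - by move/theta_defined => [_]; apply; rewrite (pq o).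
  apply: (@point_eq _ _ (rep (p i))); first by rewrite (pq i).
    exact: sim_class qx (sim_comp_anti Iq i aI Iax).
  exact: class_rep.
have Ip := ideal_prime (p i).
split=> [j|]; first exact: pr.
apply: sim_class (class_rep _) (sim_sym _); apply: (@sim_comp_anti _ Ip a).
  by move=> j; rewrite (pr i j); apply: rep_not_ideal.
by apply: contrapT => Iax; apply: nx; split=> //; rewrite (pr o i).
Qed.

Lemma theta_pref x y : theta (apref A x y) = rpref (theta x) (theta y).
Proof.
apply: funext => p; apply: funext => q; apply: propext.
pose a := fun j => rep (p j).
have [pq|npq] := EM (forall i, same_ideal (p i) q); last first.
  by split=> [[]|[[]|[_ []]]].
have pr : all_related same_ideal p by move=> i j; rewrite /same_ideal !pq.
have Iq := ideal_prime q.
have aI j : ~ ideal q (a j) by rewrite -(pq j); apply: rep_not_ideal.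
have classP u v : sim (ideal q) u v -> class q u <-> class q v.
  by move=> uv; split=> H; [apply: sim_class uv|apply: sim_class (sim_sym uv)].
rewrite /rpref theta_defined (pq o) -/a.
have thE u : theta u p q <-> class q (a ;; u) by split=> [[]|].
rewrite !thE.
have [Iax|Iax] := EM (ideal q (a ;; x)).
  rewrite (classP _ _ (sim_pref_r Iq y aI Iax)).
  split=> [H|[/class_not_ideal//|[]//]].
  by right; split=> // -[].
rewrite (classP _ _ (sim_pref_l Iq y Iax)); split=> [|[//|[nd _]]].
  by left.
by case: nd.
Qed.

Lemma theta_inj : injective theta.
Proof.
(* At the classes of the projections, [x] takes its own class as value.  These
   classes are points, for a projection in [I] would put [x] in [I]. *)
have main x y I : theta x = theta y -> prime I -> ~ I x -> sim I x y.
  move=> e Ip Ix.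
  have [|p pP] := @exists_points I (anti z) Ip.
    by apply: (@not_prime_comp _ Ip _ x); rewrite (comp_proj L).
  have [q [qI qx]] := exists_point Ip Ix.
  have pq i : same_ideal (p i) q by rewrite /same_ideal qI; case: (pP i).
  have pc i : class (p i) (anti z i) by case: (pP i).
  have : theta x p q by apply/(thetaP x pq pc); rewrite (comp_proj L).
  rewrite e => /(thetaP y pq pc); rewrite (comp_proj L) => qy.
  by rewrite -qI; apply: class_sim.
move=> x y e; apply: contrapT => /exists_prime[I Ip]; apply.
have [Ix|Ix] := EM (I x); last exact: main.
have [Iy|Iy] := EM (I y); last exact/sim_sym/main.
exact: sim_trans (sim_zero Ix) (sim_sym (sim_zero Iy)).
Qed.

Definition representation : pfun_algebra n.
Proof.
refine (@PfunAlgebra n point same_ideal same_ideal_equivalence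
  (fun f => exists x, theta x = f) _ _ _ _ _ _).
- by move=> _ [x <-]; apply: theta_pfun.
- by move=> _ [x <-]; apply: theta_respects.
- move=> f _ fP [x <-]; exists ((fun i => sval (cid (fP i))) ;; x).
  by rewrite theta_comp; congr rcomp; apply: funext => i; case: cid.
- by move=> i _ [x <-]; exists (anti x i); apply: theta_anti.
- by move=> _ _ [x <-] [y <-]; exists (apref A x y); apply: theta_pref.
- by have [x] := algebra_nonempty A; constructor; exists (theta x), x.
Defined.

Lemma laws_representable : injectively_representable A.
Proof.
exists representation; split=> [_ [x <-]|]; first exact: theta_injective.
pose h x : algebra_of_pfuns representation :=
  exist _ (theta x) (ex_intro _ x erefl).
pose g (f : algebra_of_pfuns representation) : A := sval (cid (svalP f)).
exists h.
  apply: (@Bijective _ _ h g) => [x|f]; rewrite /g.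
    by apply: theta_inj; case: cid.
  by apply: sval_inj => /=; case: cid.
split=> *; apply: sval_inj => /=;
  [exact: theta_comp|exact: theta_anti|exact: theta_pref].
Qed.

End Completeness.

Theorem theorem7p4 :
  forall n : nat, 1 <= n ->
    quasivariety (@injectively_representable n) /\
    finitely_axiomatised_by (@injectively_representable n) (axioms n).
Proof.
move=> n n_gt0.
have ax : finitely_axiomatised_by (@injectively_representable n) (axioms n).
  move=> A; split=> [[P [P_inj [h h_bij h_hom]]] q qax|/lawsP[z L]].
    apply: (satisfies_iso h_bij h_hom).
    by apply: (proj1 (lawsP _) (laws_pfuns n_gt0 P_inj)).
  exact: laws_representable n_gt0 L.
by split=> //; exists (fun q => List.In q (axioms n)).
Qed.
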